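(* Let $p$ be an odd prime, $f(x)\in\mathbb{Z}[x]$, $n\ge 1$, and let $\sigma=(x_1,\dots,x_k)$ be a cycle of length $k$ of the map $f_n:\mathbb{Z}/p^n\mathbb{Z}\to\mathbb{Z}/p^n\mathbb{Z}$, where the $x_i$ are viewed as integers representing their classes mod $p^n$. Let $g=f^k$ be the $k$-th iterate of $f$, let $a_n=g'(x_1)\in\mathbb{Z}$ and $b_n=(g(x_1)-x_1)/p^n\in\mathbb{Z}$. Let $X_i\subset\mathbb{Z}/p^{n+1}\mathbb{Z}$ be the set of the $p$ elements congruent to $x_i$ mod $p^n$, and $X=X_1\cup\dots\cup X_k$. Then $f_{n+1}(X)\subseteq X$, $g_{n+1}(X_1)\subseteq X_1$, every cycle of $f_{n+1}$ in $X$ has length divisible by $k$, and under the bijection $\mathbb{Z}/p\mathbb{Z}\to X_1$, $t\mapsto x_1+p^nt$, the restriction of $g_{n+1}$ to $X_1$ corresponds to the affine map $\Phi:\mathbb{Z}/p\mathbb{Z}\to\mathbb{Z}/p\mathbb{Z}$, $\Phi(t)=b_n+a_nt$. Consequently: (1) if $a_n\equiv1\pmod p$ and $b_n\not\equiv0\pmod p$, then $f_{n+1}$ restricted to $X$ consists of a single cycle of length $pk$; (2) if $a_n\equiv1\pmod p$ and $b_n\equiv0\pmod p$, then $f_{n+1}$ restricted to $X$ consists of $p$ cycles, each of length $k$; (3) if $a_n\equiv0\pmod p$, then $f_{n+1}$ restricted to $X$ contains exactly one cycle, of length $k$, and the remaining points of $X$ are mapped into this cycle by $f_{n+1}^k$;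 (4) if $a_n\not\equiv0,1\pmod p$ and $d$ is the order of $a_n$ in $(\mathbb{Z}/p\mathbb{Z})^*$, then $f_{n+1}$ restricted to $X$ consists of one cycle of length $k$ and $(p-1)/d$ cycles of length $kd$.
   Context: For $F\in\mathbb{Z}[x]$, $F_n$ denotes the map $\mathbb{Z}/p^n\mathbb{Z}\to\mathbb{Z}/p^n\mathbb{Z}$, $x\mapsto F(x)\bmod p^n$. A cycle of $f_n$ of length $k$ is a tuple $(x_1,\dots,x_k)$ of distinct elements of $\mathbb{Z}/p^n\mathbb{Z}$ with $f_n(x_i)=x_{i+1}$ for $i<k$ and $f_n(x_k)=x_1$. Powers $f^k$ denote iterates (compositions), not products. *)

(* Defs.v *)
From mathcomp Require Import all_boot all_order all_algebra all_fingroup.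

Set Implicit Arguments.
Unset Strict Implicit.
Unset Printing Implicit Defensive.

Import GRing.Theory.
Local Open Scope ring_scope.

(* 'Z_m is Z/mZ only for 1 < m; the moduli used here are the p ^ n with p prime
   and 0 < n. *)
Definition polymap (m : nat) (F : {poly int}) (x : 'Z_m) : 'Z_m :=
  (map_poly intr F).[x].

Definition iter_poly (f : {poly int}) (k : nat) : {poly int} :=
  iter k (fun h => f \Po h) 'X.

(* The cycle (x_1, ..., x_k), k >= 1, is the list [:: x_1; ...; x_k]; fcycle
   says that f sends each entry to the next one, and the last to the first. *)
Definition is_cycle (T : eqType) (f : T -> T) (c : seq T) : bool :=
  [&& c != [::], fcycle f c & uniq c].

(* The restriction of f to X consists of pairwise disjoint cycles covering X,
   whose lengths, counted with multiplicity, are listed by ls. *)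
Definition consists_of_cycles (T : finType) (f : T -> T) (X : {set T})
    (ls : seq nat) : Prop :=
  exists cs : seq (seq T),
    [/\ all (is_cycle f) cs, uniq (flatten cs), flatten cs =i X
      & map size cs = ls].

Definition lift_set (p n : nat) (x : int) : {set 'Z_(p ^ n.+1)} :=
  [set y : 'Z_(p ^ n.+1) | ((y : nat)%:Z == x %[mod (p ^ n)%N%:Z])%Z].

(* t |-> x + p^n t, computed on the representative of t in {0, ..., p-1}. *)
Definition lift_map (p n : nat) (x : int) (t : 'F_p) : 'Z_(p ^ n.+1) :=
  (x + (p ^ n)%N%:Z * (t : nat)%:Z)%:~R.

Arguments polymap m F x : clear implicits.
Arguments lift_map p n x t : clear implicits.

(* Main.v *)
Require Import Defs.
From mathcomp Require Import all_boot all_order all_algebra all_fingroup.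
From mathcomp Require Import cyclic fingraph ring.

Set Implicit Arguments.
Unset Strict Implicit.
Unset Printing Implicit Defensive.

(* Reduction mod p^n semiconjugates f_{n+1} to f_n, and X is the preimage of the
   cycle sigma; the return map to the fibre X_1 is g_{n+1}, which Taylor's formula
   turns into the affine map Phi of F_p.  A Phi-cycle of length m lifts to an
   f_{n+1}-cycle of length k m, and the lifts fill X by counting, so cases (1),
   (2), (4) reduce to the orbits of an affine bijection.  In case (3) Phi is
   constant, hence so is the second iterate of the return map on every fibre X_i;
   that iterate is affine of slope a_i^2, so a_i = 0 mod p and already the first
   return to X_i is constant.  No chain rule is needed to compare the a_i. *)

(** * Cycles and orbits of a self-map of a finite type *)

Section Cycles.
Variables (T : finType) (f : T -> T).

Lemma fcycle_traject x m : iter m f x = x -> fcycle f (traject f x m).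
Proof.
case: m => // m fx; rewrite trajectS /= rcons_path fpath_traject last_traject.
by rewrite /= -iterS fx eqxx.
Qed.

Lemma fcycle_iter_size c x : fcycle f c -> uniq c -> x \in c ->
  iter (size c) f x = x.
Proof.
by move=> fc Uc xc; rewrite -(order_cycle fc Uc xc) (iter_order_cycle fc).
Qed.

Lemma mem_fcycle_iter c x m : fcycle f c -> x \in c -> iter m f x \in c.
Proof. by move=> fc xc; elim: m => //= m; apply: mem_fcycle. Qed.

(** Full turns do nothing, so only the remainder of [m] modulo [size c] counts; it is below the
    order of [x], hence is recovered from the iterate by [findex] and vanishes when the iterate is
    [x]. *)
Lemma iter_id_dvdn c x m : fcycle f c -> uniq c -> x \in c ->
  (iter m f x == x) = (size c %| m).
Proof.
move=> fc Uc xc; have iterM j : iter (j * size c) f x = x.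
  by elim: j => //= j IHj; rewrite mulSn iterD IHj fcycle_iter_size.
rewrite {1}(divn_eq m (size c)) addnC iterD iterM /dvdn.
have ltmc : m %% size c < order f x.
  by rewrite (order_cycle fc Uc xc) ltn_mod; case: (c) xc.
apply/eqP/eqP=> [fx | -> //].
by rewrite -(findex_iter ltmc) fx findex0.
Qed.

(** Rotated so as to start at [x], both lists become [orbit f x]. Cycles are lists here, so
    uniqueness of a cycle can only mean uniqueness up to rotation. *)
Lemma fcycle_rot c c' x : fcycle f c -> uniq c -> fcycle f c' -> uniq c' ->
  x \in c -> x \in c' -> exists i, c' = rot i c.
Proof.
move=> fc Uc fc' Uc' xc xc'; have := orbitE fc' Uc' xc'.
rewrite (orbitE fc Uc xc) => /(congr1 (rotr (index x c'))); rewrite rotK => <-.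
rewrite /rotr rot_add_mod ?index_size ?size_rot ?leq_subr //.
by eexists.
Qed.

Lemma is_cycle_orbit x : injective f -> is_cycle f (orbit f x).
Proof.
move=> injf; rewrite /is_cycle orbit_uniq cycle_orbit // !andbT.
by rewrite -size_eq0 size_orbit -lt0n.
Qed.

Lemma order_eq x d : injective f -> (forall m, (iter m f x == x) = (d %| m)) ->
  order f x = d.
Proof.
move=> injf fd; apply/eqP; rewrite eqn_dvd -[X in X %| d]size_orbit.
rewrite -(iter_id_dvdn _ (cycle_orbit injf x) (orbit_uniq f x) (in_orbit f x)).
by rewrite fd dvdnn -fd iter_order ?eqxx.
Qed.

(** One orbit is taken for each root of a connected component of [f]. The roots may come in any
    order, which allows a chosen length to head the list. *)
Lemma consists_of_orbits rs : injective f -> perm_eq rs (enum (froots f)) ->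
  consists_of_cycles f [set: T] [seq order f r | r <- rs].
Proof.
move=> injf rsP; have symf := fconnect_sym injf.
exists [seq orbit f r | r <- rs]; split.
- by apply/allP=> _ /mapP[r _ ->]; apply: is_cycle_orbit.
- have rs_root r : r \in rs -> froot f r = r.
    by rewrite (perm_mem rsP) mem_enum => /eqP.
  have: uniq rs by rewrite (perm_uniq rsP) enum_uniq.
  elim: rs rs_root {rsP} => //= r rs IHrs rs_root /andP[rNrs Urs].
  rewrite cat_uniq orbit_uniq IHrs // ?andbT => [|z zrs]; last first.
    by apply: rs_root; rewrite inE zrs orbT.
  apply/hasPn=> y /flattenP[_ /mapP[z zrs ->]]; rewrite -!fconnect_orbit => zy.
  apply: contra rNrs => ry; suff -> : r = z by [].
  rewrite -(rs_root r) ?mem_head // -(rs_root z) ?inE ?zrs ?orbT //.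
  by apply/rootP=> //; apply: connect_trans ry _; rewrite symf.
- move=> y; rewrite inE; apply/flattenP; exists (orbit f (froot f y)).
    by apply: map_f; rewrite (perm_mem rsP) mem_enum; apply: roots_root.
  by rewrite -fconnect_orbit symf connect_root.
- by rewrite -map_comp; apply: eq_map => r; rewrite /= size_orbit.
Qed.

Lemma consists_of_cycles_ext g X ls : f =1 g ->
  consists_of_cycles f X ls -> consists_of_cycles g X ls.
Proof.
move=> fg [cs [fcs Ucs csX <-]]; exists cs; split=> //.
apply: sub_all fcs => c /and3P[c_neq0 fc Uc].
by rewrite /is_cycle c_neq0 Uc -(eq_fcycle fg) fc.
Qed.

Lemma sumn_cycles X ls : consists_of_cycles f X ls -> sumn ls = #|X|.
Proof.
case=> cs [_ Ucs csX <-]; rewrite -(eq_card csX) (card_uniqP Ucs).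
by rewrite size_flatten.
Qed.

(** The lengths are all [d] and sum to the cardinal of [T], which determines how many there are. *)
Lemma consists_of_orbits_const d : injective f -> 0 < d ->
  (forall x, order f x = d) ->
  consists_of_cycles f [set: T] (nseq (#|T| %/ d) d).
Proof.
move=> injf d_gt0 fd; have := consists_of_orbits injf (perm_refl _).
set ls := map _ _ => Hc.
have lsE : ls = nseq (size ls) d.
  by apply/all_pred1P/allP=> _ /mapP[x _ ->] /=; rewrite fd.
move: lsE Hc; set m := size ls => -> Hc; have := sumn_cycles Hc.
by rewrite sumn_nseq cardsT => <-; rewrite mulKn.
Qed.

Lemma consists_of_orbits_fix x0 d : injective f -> 0 < d -> f x0 = x0 ->
  (forall x, x != x0 -> order f x = d) ->
  consists_of_cycles f [set: T] (1 :: nseq ((#|T| - 1) %/ d) d).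
Proof.
move=> injf d_gt0 fx0 fd; have o0 : order f x0 = 1.
  apply: order_eq => // m; rewrite dvd1n.
  by elim: m => [|m /eqP IHm] /=; rewrite ?IHm ?fx0 eqxx.
have root0 : x0 \in enum (froots f).
  rewrite mem_enum; apply/eqP.
  have := connect_root (frel f) x0.
  by rewrite fconnect_orbit /orbit o0 /= inE => /eqP.
(* The fixed point is its own root; moving it to the front separates its length 1 from the others,
   which are then counted. *)
have := @consists_of_orbits (x0 :: rem x0 (enum (froots f))) injf.
rewrite /= o0 perm_sym perm_to_rem //; set ls := map _ _ => /(_ isT) Hc.
have lsE : ls = nseq (size ls) d.
  apply/all_pred1P/allP=> _ /mapP[x xls ->] /=.
  by move: xls; rewrite mem_rem_uniq ?enum_uniq // inE => /andP[/fd->].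
move: lsE Hc; set m := size ls => -> Hc; have := sumn_cycles Hc.
by rewrite /= sumn_nseq cardsT => <-; rewrite addKn mulKn.
Qed.

End Cycles.

(** * Lifting cycles along a semiconjugacy *)

Section Lift.

(* [L] parametrizes the fibre of [q] over [z0], and [Phi] is the return map of
   [h] to that fibre in this parametrization. *)
Variables (T S A : finType) (h : T -> T) (h' : S -> S) (q : T -> S).
Variables (s : seq S) (X : {set T}) (z0 : S) (L : A -> T) (Phi : A -> A).
Hypothesis qh : forall y, q (h y) = h' (q y).
Hypothesis s_cycle : is_cycle h' s.
Hypothesis XE : forall y, (y \in X) = (q y \in s).
Hypothesis z0s : z0 \in s.
Hypothesis L_inj : injective L.
Hypothesis L_im : forall y, q y = z0 -> exists t, y = L t.
Hypothesis qL : forall t, q (L t) = z0.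
Hypothesis hL : forall t, iter (size s) h (L t) = L (Phi t).

Let k := size s.

Lemma semiconj_iter m y : q (iter m h y) = iter m h' (q y).
Proof. by elim: m => //= m IHm; rewrite qh IHm. Qed.

Let fs : fcycle h' s. Proof. by case/and3P: s_cycle. Qed.
Let Us : uniq s. Proof. by case/and3P: s_cycle. Qed.

Lemma preim_cycle_stable y : y \in X -> h y \in X.
Proof. by rewrite !XE qh; apply: mem_fcycle. Qed.

(** A cycle upstairs projects to a closed walk around [s], which makes a whole number of turns. *)
Lemma dvdn_size_lifted_cycle c : is_cycle h c -> {subset c <= X} -> k %| size c.
Proof.
case: c => [//|y c] /and3P[_ fc Uc] cX; have yc := mem_head y c.
rewrite /k -(iter_id_dvdn _ fs Us (x := q y)) -?XE ?cX //.
by rewrite -semiconj_iter fcycle_iter_size.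
Qed.

(** Each [t] is replaced by the [k] points visited from [L t] before the next return to the
    fibre. *)
Definition lift_cycle (c : seq A) := flatten [seq traject h (L t) k | t <- c].

Lemma size_lift_cycle c : size (lift_cycle c) = (k * size c)%N.
Proof.
by elim: c => [|t c IHc]; rewrite ?muln0 //= size_cat size_traject IHc mulnS.
Qed.

Lemma lift_cycle_traject t m :
  lift_cycle (traject Phi t m) = traject h (L t) (m * k).
Proof. by elim: m t => //= m IHm t; rewrite mulSn trajectD hL -IHm. Qed.

Lemma fcycle_lift_cycle c : fcycle Phi c -> fcycle h (lift_cycle c).
Proof.
case: c => [//|t c] fc; have cE := fcycle_consE fc.
rewrite cE lift_cycle_traject; apply: fcycle_traject.
have iterLM m u : iter (m * k) h (L u) = L (iter m Phi u).
  by elim: m u => // m IHm u; rewrite mulSn addnC iterD hL IHm -iterSr.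
rewrite iterLM; congr L.
move: fc; rewrite /= rcons_path => /andP[/fpathE->] /=.
by rewrite last_traject size_traject => /eqP.
Qed.

Lemma lift_cycle_sub c y : y \in lift_cycle c -> y \in X.
Proof.
case/flattenP=> _ /mapP[t _ ->] /trajectP[i _ ->].
by rewrite XE semiconj_iter qL mem_fcycle_iter.
Qed.

Lemma return_index y : y \in X -> exists2 i, i <= k & q (iter i h y) = z0.
Proof.
rewrite XE => ys; exists (findex h' (q y) z0).
  by rewrite /k -(order_cycle fs Us ys) ltnW // findex_max // (fconnect_cycle fs).
by rewrite semiconj_iter iter_findex // (fconnect_cycle fs).
Qed.

(** Injectivity is asked on [c] only, so that the lemma also serves a constant [Phi] with a
    one-point [c]. *)
Lemma lift_cycle_uniq c :
  {in c &, injective Phi} -> uniq c -> uniq (lift_cycle c).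
Proof.
move=> injPhi Uc; have trajE y : traject h y k = [seq iter i h y | i <- iota 0 k].
  elim: k => // m IHm.
  by rewrite trajectSr IHm -addn1 iotaD map_cat cats1.
have -> : lift_cycle c = [seq iter i h (L t) | t <- c, i <- iota 0 k].
  by congr flatten; apply: eq_map.
apply: allpairs_uniq; rewrite ?iota_uniq // => ti uj.
move=> /allpairsP[[t i] [/= tc ik ->]] /allpairsP[[u j] [/= uc jk ->]] /= eq_tu.
move: ik jk; rewrite !mem_iota !add0n /= => ik jk.
(* The projection of a point to [s] tells how many steps separate it from the fibre over [z0]. Once
   these agree, completing the turn to [k] steps gives [Phi t = Phi u]. *)
have eq_ij : i = j.
  move: (congr1 (findex h' z0 \o q) eq_tu) => /=.
  by rewrite !semiconj_iter !qL !findex_iter ?(order_cycle fs Us z0s).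
rewrite -eq_ij in eq_tu *; congr (_, _); apply: injPhi => //; apply: L_inj.
by rewrite -!hL -/k -(subnK (ltnW ik)) !iterD eq_tu.
Qed.

Hypothesis cardX : #|X| = (k * #|A|)%N.

Lemma consists_of_lift_cycles ls : injective Phi ->
  consists_of_cycles Phi [set: A] ls ->
  consists_of_cycles h X [seq (k * l)%N | l <- ls].
Proof.
move=> injPhi [cs [csPhi Ucs csT <-]]; exists [seq lift_cycle c | c <- cs].
have csE : flatten [seq lift_cycle c | c <- cs] = lift_cycle (flatten cs).
  rewrite /lift_cycle; elim: (cs) => //= c cs' ->.
  by rewrite map_cat flatten_cat.
have Ulift : uniq (lift_cycle (flatten cs)).
  by apply: lift_cycle_uniq => // ? ? _ _; apply: injPhi.
have k_gt0 : 0 < k by rewrite /k; case: (s) z0s.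
split.
- apply/allP=> _ /mapP[c ccs ->].
  have /and3P[c_neq0 fc Uc] := allP csPhi c ccs.
  rewrite /is_cycle fcycle_lift_cycle // lift_cycle_uniq // ?andbT => [|? ? _ _].
    by rewrite -size_eq0 size_lift_cycle muln_eq0 negb_or -lt0n k_gt0 size_eq0.
  exact: injPhi.
- by rewrite csE.
- rewrite csE => y; apply/idP/idP; first exact: lift_cycle_sub.
  move: y; apply/subsetP.
  (* Both sets have [k * #|A|] elements, so this inclusion is an equality. *)
  have sub : lift_cycle (flatten cs) \subset X.
    by apply/subsetP=> y; apply: lift_cycle_sub.
  have := subset_cardP _ sub; rewrite cardX (card_uniqP Ulift) size_lift_cycle.
  rewrite -(card_uniqP Ucs) (eq_card csT) cardsT => /(_ erefl) eqX.
  by apply/subsetP=> y; rewrite eqX.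
- by rewrite -!map_comp; apply: eq_map => c; rewrite /= size_lift_cycle.
Qed.

(** The cycle is the lift of the fixed point [b] of [Phi]. The last clause provides a point of the
    cycle in every fibre, to be compared with an arbitrary point of that fibre. *)
Lemma constant_return b : (forall t, Phi t = b) ->
  exists c, [/\ is_cycle h c, size c = k, {subset c <= X},
    forall c', is_cycle h c' -> {subset c' <= X} -> exists i, c' = rot i c
  & forall z, z \in s -> exists2 w, w \in c & q w = z].
Proof.
move=> PhiE; exists (lift_cycle [:: b]).
have fc : fcycle h (lift_cycle [:: b]).
  by apply: fcycle_lift_cycle; rewrite /= PhiE eqxx.
have Uc : uniq (lift_cycle [:: b]).
  by apply: lift_cycle_uniq => // t u; rewrite !inE => /eqP-> /eqP->.
have size_c : size (lift_cycle [:: b]) = k by rewrite size_lift_cycle muln1.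
have k_gt0 : 0 < k by rewrite /k; case: (s) z0s.
have bc : L b \in lift_cycle [:: b].
  by rewrite /lift_cycle /= cats0 -(prednK k_gt0) mem_head.
split=> //.
- by rewrite /is_cycle -size_eq0 size_c -lt0n k_gt0 fc.
- exact: lift_cycle_sub.
- case=> [//|y c'] /and3P[_ fc' Uc'] c'X.
  (* Any cycle in [X] enters the fibre over [z0], and one return later it is at [L b]; it therefore
     shares a point with the lift. *)
  have [i _ /L_im[t iy]] := return_index (c'X y (mem_head _ _)).
  apply: (fcycle_rot fc Uc fc' Uc' bc).
  rewrite -(PhiE t) -hL -iy; apply: mem_fcycle_iter => //.
  by apply: mem_fcycle_iter; rewrite ?mem_head.
- move=> z zs; have z0z : fconnect h' z0 z by rewrite (fconnect_cycle fs).
  exists (iter (findex h' z0 z) h (L b)); first exact: mem_fcycle_iter.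
  by rewrite semiconj_iter qL iter_findex.
Qed.

(** Both points reach the fibre over [z0] after the same [i <= k] steps and coincide at [L b] after
    [k] more; the remaining [k - i] steps complete two turns. *)
Lemma constant_double_return b y y' : (forall t, Phi t = b) ->
  y \in X -> q y = q y' -> iter k h (iter k h y) = iter k h (iter k h y').
Proof.
move=> PhiE yX qy; have [i lei qiy] := return_index yX.
have [t iy] := L_im qiy; have [u iy'] : exists u, iter i h y' = L u.
  by apply: L_im; rewrite semiconj_iter -qy -semiconj_iter.
rewrite -!iterD; have -> : k + k = k - i + (k + i) by rewrite addnCA subnK.
by rewrite !iterD iy iy' !hL !PhiE.
Qed.

End Lift.

(** * Integers in residue rings, and Taylor's formula *)

Import GRing.Theory.
Local Open Scope ring_scope.

Lemma intr_eq0_dvdz (R : pzRingType) (m : nat) :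
  (forall n : nat, (n%:R == 0 :> R) = (m %| n)%N) ->
  forall z : int, (z%:~R == 0 :> R) = (m%:Z %| z)%Z.
Proof. by move=> Rm [n|n]; rewrite ?NegzE ?mulrNz ?oppr_eq0 Rm ?dvdzN. Qed.

Lemma intr_Zp_eq0 m (z : int) : (1 < m)%N ->
  (z%:~R == 0 :> 'Z_m) = (m%:Z %| z)%Z.
Proof.
move=> m_gt1; apply: intr_eq0_dvdz => n.
by rewrite -val_eqE /= val_Zp_nat.
Qed.

Lemma intr_Fp_eq0 p (z : int) : prime p ->
  (z%:~R == 0 :> 'F_p) = (p%:Z %| z)%Z.
Proof.
by move=> p_pr; apply: intr_eq0_dvdz => n; rewrite (dvdn_pcharf (pchar_Fp p_pr)).
Qed.

Lemma intr_Zp_eq m (z z' : int) : (1 < m)%N ->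
  (z%:~R == z'%:~R :> 'Z_m) = (z == z' %[mod m%:Z])%Z.
Proof. by move=> m_gt1; rewrite -subr_eq0 -intrB intr_Zp_eq0 // eqz_mod_dvd. Qed.

Lemma intr_Fp_eq p (z z' : int) : prime p ->
  (z%:~R == z'%:~R :> 'F_p) = (z == z' %[mod p%:Z])%Z.
Proof. by move=> p_pr; rewrite -subr_eq0 -intrB intr_Fp_eq0 // eqz_mod_dvd. Qed.

Lemma intr_Zp_val m (y : 'Z_m) : ((y : nat)%:Z)%:~R = y.
Proof. exact: natr_Zp. Qed.

Lemma polymap_intr m F (z : int) : polymap m F z%:~R = (F.[z])%:~R.
Proof. exact: horner_map. Qed.

Lemma polymap_iter_poly m f k (y : 'Z_m) :
  polymap m (iter_poly f k) y = iter k (polymap m f) y.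
Proof.
rewrite /polymap; elim: k => [|k IHk] /=; first by rewrite map_polyX hornerX.
by rewrite map_comp_poly horner_comp IHk.
Qed.

(** Only divisibility of the remainder by [h ^+ 2] matters, so [r] is left unspecified; induction on
    [F] avoids the division by 2 of the usual coefficient. *)
Lemma horner_taylor2 (R : comNzRingType) (F : {poly R}) (x h : R) :
  exists r, F.[x + h] = F.[x] + F^`().[x] * h + h ^+ 2 * r.
Proof.
elim/poly_ind: F => [|F c [r IHr]]; first by exists 0; rewrite deriv0 !horner0; ring.
exists (F^`().[x] + (x + h) * r); rewrite !derivE !hornerE IHr; ring.
Qed.

(** * Reduction from Z/p^(n+1) to Z/p^n and its fibres *)

Section Reduction.
Variables (p n : nat).
Hypotheses (p_prime : prime p) (n_gt0 : (0 < n)%N).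

Definition reduce (y : 'Z_(p ^ n.+1)) : 'Z_(p ^ n) := (y : nat)%:R.

Let p_gt1 := prime_gt1 p_prime.

Lemma pfactor_gt1 m : (0 < m)%N -> (1 < p ^ m)%N.
Proof. by move=> m_gt0; rewrite -{1}(expn0 p) ltn_exp2l. Qed.

Let pn_gt1 := pfactor_gt1 n_gt0.
Let pn1_gt1 := pfactor_gt1 (ltn0Sn n).

(** [reduce] goes through the canonical representative; since p^n divides p^(n+1), any integer
    representative gives the same class. *)
Lemma reduce_intr (z : int) : reduce z%:~R = z%:~R.
Proof.
rewrite /reduce -[_%:R]/((_%:Z)%:~R); apply/eqP; rewrite intr_Zp_eq //.
have : ((z%:~R : 'Z_(p ^ n.+1)) : nat)%:Z%:~R == z%:~R :> 'Z_(p ^ n.+1).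
  by rewrite intr_Zp_val.
rewrite intr_Zp_eq // !eqz_mod_dvd; apply: dvdz_trans.
by rewrite dvdzE /= dvdn_exp2l.
Qed.

Lemma reduce_polymap F y :
  reduce (polymap (p ^ n.+1) F y) = polymap (p ^ n) F (reduce y).
Proof. by rewrite -(intr_Zp_val y) polymap_intr !reduce_intr polymap_intr. Qed.

Lemma in_lift_set (z : int) y : (y \in lift_set p n z) = (reduce y == z%:~R).
Proof. by rewrite inE -intr_Zp_eq. Qed.

(** Changing [t] by a multiple of p changes the right side by a multiple of p^(n+1). *)
Lemma lift_map_intr (z t : int) :
  lift_map p n z (t%:~R : 'F_p) = (z + (p ^ n)%N%:Z * t)%:~R.
Proof.
apply/eqP; rewrite intr_Zp_eq // eqz_mod_dvd opprD addrACA subrr add0r -mulrBr.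
rewrite expnSr PoszM dvdz_mul2l ?eqz_nat -?lt0n ?(ltnW pn_gt1) //.
by rewrite -intr_Fp_eq0 // intrB intr_Zp_val subrr.
Qed.

Lemma lift_map_inj z : injective (lift_map p n z).
Proof.
move=> t u /eqP; rewrite intr_Zp_eq // eqz_mod_dvd opprD addrACA subrr add0r.
rewrite -mulrBr expnSr PoszM dvdz_mul2l ?eqz_nat -?lt0n ?(ltnW pn_gt1) //.
by rewrite -intr_Fp_eq0 // intrB !intr_Zp_val subr_eq0 => /eqP.
Qed.

Lemma reduce_lift_map z t : reduce (lift_map p n z t) = z%:~R.
Proof.
rewrite /lift_map reduce_intr; apply/eqP; rewrite intr_Zp_eq // eqz_mod_dvd.
by rewrite addrAC subrr add0r dvdz_mulr.
Qed.

Lemma lift_map_surj z y : reduce y = z%:~R -> exists t, y = lift_map p n z t.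
Proof.
move/eqP; rewrite -(intr_Zp_val y) reduce_intr intr_Zp_eq // eqz_mod_dvd.
case/dvdzP=> t yz; exists t%:~R; rewrite lift_map_intr; congr _%:~R.
by rewrite mulrC -yz addrC subrK.
Qed.

Lemma lift_map_im z : lift_map p n z @: [set: 'F_p] = lift_set p n z.
Proof.
apply/setP=> y; rewrite in_lift_set; apply/imsetP/eqP => [[t _ ->]|].
  exact: reduce_lift_map.
by case/lift_map_surj=> t ->; exists t.
Qed.

Lemma card_lift_set z : #|lift_set p n z| = p.
Proof. by rewrite -lift_map_im card_imset ?cardsT ?card_Fp //; apply: lift_map_inj. Qed.

(** Taylor's formula at [z] with increment p^n t: the remainder is a multiple of p^(2n), which
    vanishes mod p^(n+1) because n >= 1. *)
Lemma polymap_lift_map (g : {poly int}) z t :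
  ((p ^ n)%N%:Z %| g.[z] - z)%Z ->
  polymap (p ^ n.+1) g (lift_map p n z t) =
  lift_map p n z (((g.[z] - z) %/ (p ^ n)%N%:Z)%Z%:~R + (g^`()).[z]%:~R * t).
Proof.
move=> dvd_gz; set b := (_ %/ _)%Z.
have gzE : g.[z] = z + (p ^ n)%N%:Z * b by rewrite mulrC divzK // addrC subrK.
rewrite -{2}(intr_Zp_val t) -intrM -intrD lift_map_intr.
rewrite /lift_map polymap_intr.
have [r ->] := horner_taylor2 g z ((p ^ n)%N%:Z * (t : nat)%:Z).
apply/eqP; rewrite intr_Zp_eq // gzE eqz_mod_dvd.
set P := (p ^ n)%N%:Z; set u := (t : nat)%:Z; set a := (g^`()).[z].
have -> : z + P * b + a * (P * u) + (P * u) ^+ 2 * r - (z + P * (b + a * u))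
   = P * P * (u ^+ 2 * r) by ring.
by rewrite dvdz_mulr // -PoszM -expnD dvdzE /= dvdn_exp2l // -addn1 leq_add2l.
Qed.

End Reduction.

(** * Orbits of affine maps of F_p *)

Section Affine.
Variables (p : nat) (b a : 'F_p).
Hypothesis p_prime : prime p.

Lemma translation_cycles : b != 0 ->
  consists_of_cycles (fun t => b + t) [set: 'F_p] [:: p].
Proof.
move=> b_neq0; have injf : injective (fun t => b + t) by apply: addrI.
have iterE m t : iter m (fun t => b + t) t = m%:R * b + t.
  by elim: m => [|m /= ->]; rewrite ?mul0r ?add0r // mulrSr mulrDl mul1r addrCA addrA.
have := @consists_of_orbits_const _ _ p injf (prime_gt0 p_prime).
rewrite card_Fp // divnn prime_gt0 //; apply=> t; apply: order_eq => // m.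
rewrite iterE -[X in _ == X]add0r (inj_eq (addIr _)) mulf_eq0 (negPf b_neq0).
by rewrite orbF -(dvdn_pcharf (pchar_Fp p_prime)).
Qed.

Lemma affine_inj : a != 0 -> injective (fun t => b + a * t).
Proof. by move=> a_neq0 t u /addrI/(mulfI a_neq0). Qed.

Lemma affine_cycles (u : {unit 'F_p}) : val u = a -> a != 1 ->
  consists_of_cycles (fun t => b + a * t) [set: 'F_p]
    (1%N :: nseq ((p - 1) %/ #[u]%g) #[u]%g).
Proof.
move=> ua a_neq1; have a_neq0 : a != 0 by rewrite -ua -unitfE (valP u).
have a1 : 1 - a != 0 by rewrite subr_eq0 eq_sym.
(* This is the fixed point; centred there, the map is multiplication by [a], so any other point
   returns after [m] steps exactly when [a ^+ m = 1]. *)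
pose t0 := b / (1 - a).
have ft t : b + a * t = t0 + a * (t - t0).
  by rewrite /t0; field.
have iterE m t : iter m (fun t => b + a * t) t = t0 + a ^+ m * (t - t0).
  elim: m => [|m /= ->]; first by rewrite mul1r addrC subrK.
  by rewrite ft addrAC subrr add0r exprS mulrA.
have injf := affine_inj a_neq0; rewrite -[in (p - 1)%N](card_Fp p_prime).
apply: (@consists_of_orbits_fix _ _ t0); rewrite ?order_gt0 //.
  by rewrite ft; ring.
move=> t t_neq; apply: order_eq => // m.
have uX : val (u ^+ m)%g = a ^+ m by rewrite -ua; apply: FinRing.val_unitX.
have -> : (#[u]%g %| m)%N = (a ^+ m == 1).
  rewrite order_dvdn; apply/eqP/eqP => [u1 | am].
    by rewrite -uX u1.
  by apply: val_inj; apply: etrans uX am.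
rewrite iterE.
rewrite -{2}[t](subrK t0) addrC (inj_eq (addIr _)) -subr_eq0.
by rewrite -{2}[t - t0]mul1r -mulrBl mulf_eq0 !subr_eq0 (negPf t_neq) orbF.
Qed.

(* [Phi (Phi t)] has slope [a ^ 2]. *)
Lemma affine_double_const :
  (forall t, b + a * (b + a * t) = b + a * (b + a * 0)) -> a = 0.
Proof.
move=> /(_ 1) /eqP; rewrite -subr_eq0.
have -> : b + a * (b + a * 1) - (b + a * (b + a * 0)) = a ^+ 2 by ring.
by rewrite expf_eq0 => /eqP.
Qed.

End Affine.

(** * Dynamics of f on the lifted cycle: the return map and the four cases *)

Theorem mainTheorem1 (p n k : nat) (f : {poly int}) (x : k.-tuple int)
  (p_prime : prime p) (p_odd : odd p) (n_gt0 : (0 < n)%N)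
  (sigma_cycle : is_cycle (polymap (p ^ n) f)
                   [seq y%:~R : 'Z_(p ^ n) | y <- x]) :
  let x1 : int := x`_0 in
  let g := iter_poly f k in
  let a := (g^`()).[x1] in
  let b := ((g.[x1] - x1) %/ (p ^ n)%N%:Z)%Z in
  let fS := polymap (p ^ n.+1) f in
  let gS := polymap (p ^ n.+1) g in
  let X1 := lift_set p n x1 in
  let X := \bigcup_(i < k) lift_set p n (tnth x i) in
  let Phi := fun t : 'F_p => b%:~R + a%:~R * t : 'F_p in
  ((p ^ n)%N%:Z %| g.[x1] - x1)%Z
  /\ (forall i : 'I_k, #|lift_set p n (tnth x i)| = p)
  /\ fS @: X \subset X
  /\ gS @: X1 \subset X1
  /\ (forall c : seq 'Z_(p ^ n.+1),
        is_cycle fS c -> {subset c <= X} -> (k %| size c)%N)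
  /\ [/\ forall t : int,
           lift_map p n x1 (t%:~R : 'F_p) = (x1 + (p ^ n)%N%:Z * t)%:~R,
         injective (lift_map p n x1),
         lift_map p n x1 @: [set: 'F_p] = X1
       & forall t : 'F_p, gS (lift_map p n x1 t) = lift_map p n x1 (Phi t)]
  /\ ((a = 1 %[mod p])%Z -> (b <> 0 %[mod p])%Z ->
        consists_of_cycles fS X [:: p * k]%N)
  /\ ((a = 1 %[mod p])%Z -> (b = 0 %[mod p])%Z ->
        consists_of_cycles fS X (nseq p k))
  /\ ((a = 0 %[mod p])%Z ->
        exists c : seq 'Z_(p ^ n.+1),
          [/\ is_cycle fS c, size c = k, {subset c <= X},
              forall c' : seq 'Z_(p ^ n.+1),
                is_cycle fS c' -> {subset c' <= X} -> exists i, c' = rot i c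
            & forall y, y \in X -> y \notin c -> iter k fS y \in c])
  /\ ((a <> 0 %[mod p])%Z -> (a <> 1 %[mod p])%Z ->
        exists2 u : {unit 'F_p}, val u = a%:~R
          & let d := #[u]%g in
            consists_of_cycles fS X (k :: nseq ((p - 1) %/ d) (k * d)%N)).
Proof.
move=> x1 g a b fS gS X1 X Phi.
set s := [seq y%:~R : 'Z_(p ^ n) | y <- x] in sigma_cycle.
have size_s : size s = k by rewrite size_map size_tuple.
have k_gt0 : (0 < k)%N.
  by rewrite -size_s lt0n size_eq0; case/and3P: sigma_cycle.
(* As [k] is positive, [x1] is a true entry of the tuple and not the default value of [nth]. *)
have x1E : x1 = tnth x (Ordinal k_gt0) by rewrite (tnth_nth 0).
have fs : fcycle (polymap (p ^ n) f) s by case/and3P: sigma_cycle.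
have Us : uniq s by case/and3P: sigma_cycle.
have in_s i : (tnth x i)%:~R \in s by apply: map_f; apply: mem_tnth.
(* Stated at every entry because case (3) uses the affine return map on each fibre. *)
have dvd_g i : ((p ^ n)%N%:Z %| g.[tnth x i] - tnth x i)%Z.
  rewrite -intr_Zp_eq0 ?pfactor_gt1 // intrB subr_eq0 -polymap_intr.
  by rewrite polymap_iter_poly -{1}size_s fcycle_iter_size.
have dvd_g1 : ((p ^ n)%N%:Z %| g.[x1] - x1)%Z by rewrite x1E.
have z0s : x1%:~R \in s by rewrite x1E.
have qh := reduce_polymap p_prime n_gt0 f.
have XE y : (y \in X) = (reduce y \in s).
  apply/bigcupP/mapP=> [[i _]|[z zx yz]].
    by rewrite in_lift_set // => /eqP->; exists (tnth x i); rewrite ?mem_tnth.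
  by case/tnthP: zx yz => i -> yz; exists i => //; rewrite in_lift_set // yz.
have Linj := @lift_map_inj _ _ p_prime n_gt0 x1.
have Lsurj y := @lift_map_surj _ _ p_prime n_gt0 x1 y.
have qL := @reduce_lift_map _ _ p_prime n_gt0 x1.
have gL t : gS (lift_map p n x1 t) = lift_map p n x1 (Phi t).
  exact: polymap_lift_map.
have hL t : iter (size s) fS (lift_map p n x1 t) = lift_map p n x1 (Phi t).
  by rewrite size_s -gL /gS polymap_iter_poly.
(* The fibres are disjoint because the entries of [x] are distinct mod p^n. *)
have cardX : #|X| = (size s * #|'F_p|)%N.
  rewrite size_s card_Fp // -sum1_card partition_disjoint_bigcup => [|i j ij].
    under eq_bigr => i _ do rewrite sum1_card card_lift_set //.
    by rewrite sum_nat_const card_ord.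
  rewrite -setI_eq0; apply/eqP/setP=> y.
  rewrite in_setI in_set0 !in_lift_set //.
  apply: contraNF ij => /andP[/eqP-> /eqP xij]; rewrite -val_eqE /=.
  rewrite -(nth_uniq 0 _ _ Us) ?size_s ?ltn_ord //.
  by rewrite !(nth_map 0) ?size_tuple // -!tnth_nth xij.
have lift ls :=
  consists_of_lift_cycles qh sigma_cycle XE z0s Linj qL hL cardX (ls := ls).
rewrite size_s in lift.
have aE c : (a == c %[mod p])%Z = (a%:~R == c%:~R :> 'F_p) by rewrite intr_Fp_eq.
have bE c : (b == c %[mod p])%Z = (b%:~R == c%:~R :> 'F_p) by rewrite intr_Fp_eq.
split; first exact: dvd_g1.
split; first by move=> i; apply: card_lift_set.
split.
  apply/subsetP=> _ /imsetP[y yX ->].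
  exact: (preim_cycle_stable qh sigma_cycle XE).
split.
  apply/subsetP=> _ /imsetP[y yX ->]; move: yX.
  by rewrite /X1 -!lift_map_im // => /imsetP[t _ ->]; rewrite gL imset_f.
split.
  move=> c fc cX; rewrite -size_s.
  exact: (dvdn_size_lifted_cycle qh sigma_cycle XE).
split.
  by split=> // [t|]; [apply: lift_map_intr | apply: lift_map_im].
have PhiE c : a%:~R = c -> Phi =1 (fun t => b%:~R + c * t) by move=> <-.
split.
  move=> /eqP; rewrite aE => /eqP/PhiE Phi1 /eqP; rewrite bE => b_neq0.
  rewrite mulnC; apply: (lift [:: p]) => [t u|].
    by rewrite !Phi1 !mul1r => /addrI.
  apply: (consists_of_cycles_ext (f := fun t => b%:~R + t)).
    by move=> t; rewrite Phi1 mul1r.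
  exact: translation_cycles.
split.
  move=> /eqP; rewrite aE => /eqP/PhiE Phi1 /eqP; rewrite bE => /eqP b0.
  have Phi_id t : Phi t = t by rewrite Phi1 b0 mul1r add0r.
  have injPhi : injective Phi by move=> t u; rewrite !Phi_id.
  have := lift (nseq p 1%N) injPhi; rewrite map_nseq muln1; apply.
  have := consists_of_orbits_const injPhi (ltn0Sn 0).
  rewrite card_Fp // divn1; apply=> t; apply: order_eq => // m.
  by rewrite dvd1n; elim: m => [|m /= /eqP->]; rewrite ?Phi_id eqxx.
split.
  move=> /eqP; rewrite aE => /eqP/PhiE Phi0.
  have Phi_const t : Phi t = b%:~R by rewrite Phi0 mul0r addr0.
  have [c [c_cycle size_c cX c_uniq c_surj]] := 
    constant_return qh sigma_cycle XE z0s Linj Lsurj qL hL Phi_const.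
  have dbl y y' :=
    constant_double_return qh sigma_cycle XE z0s Lsurj hL (y := y) (y' := y')
      Phi_const.
  rewrite size_s in dbl.
  exists c; split=> //; first by rewrite size_c.
  move=> y yX _; have ys := yX; rewrite XE in ys.
  have [w wc qw] := c_surj _ ys.
  have [/= z /tnthP[i ->] qy] := mapP ys.
  have [t yE] := lift_map_surj p_prime n_gt0 qy.
  have [u wE] := lift_map_surj p_prime n_gt0 (etrans qw qy).
  have hLi v : iter k fS (lift_map p n (tnth x i) v) = lift_map p n (tnth x i)
      (((g.[tnth x i] - tnth x i) %/ (p ^ n)%N%:Z)%Z%:~R
       + (g^`()).[tnth x i]%:~R * v).
    by rewrite -polymap_iter_poly polymap_lift_map.
  have fc : fcycle fS c by case/and3P: c_cycle.
  (* [w] is the point of [c] in the fibre of [y]; it is enough that one return does not distinguish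
     them, which holds once the slope [ai] on that fibre is 0. *)
  suff -> : iter k fS y = iter k fS w by apply: mem_fcycle_iter.
  rewrite yE wE !hLi; congr lift_map.
  set bi : 'F_p := (_ %/ _)%Z%:~R in hLi *; set ai : 'F_p := _%:~R in hLi *.
  suff -> : ai = 0 by rewrite !mul0r.
  (* Two returns are constant on this fibre by [dbl], while their slope is the square of [ai]. *)
  apply: (@affine_double_const _ bi) => v.
  apply: (@lift_map_inj _ _ p_prime n_gt0 (tnth x i)).
  by rewrite -!hLi; apply: dbl; rewrite ?XE !reduce_lift_map.
move=> /eqP; rewrite aE => a_neq0 /eqP; rewrite aE => a_neq1.
have Ua : (a%:~R : 'F_p) \is a GRing.unit by rewrite unitfE.
exists (FinRing.unit _ Ua); first by [].
have valu : val (FinRing.unit _ Ua) = a%:~R by [].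
move=> d; have := affine_cycles b%:~R p_prime valu a_neq1.
by move/(lift _ (affine_inj a_neq0)); rewrite /= muln1 map_nseq.
Qed.
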